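(* Let $G$ be a finite group, $N$ a normal subgroup of $G$ contained in the center of $G$, and $T=\{t(\sigma):\sigma\in G/N\}$ a set of coset representatives with $t(1)=1$. Let $k\ge 2$, let $t_1,\dots,t_k$ be chosen independently and uniformly from $T$, and let $f_1,\dots,f_{k-1}\in N$ be the carries produced when multiplying $t_1,\dots,t_k$. Define a binary process $B_1,\dots,B_{k-1}$ by $$B_i=\begin{cases}1&\text{if } f_i\ne\mathrm{id},\\0&\text{if } f_i=\mathrm{id}.\end{cases}$$ Then $\{B_i\}$ is a stationary, one-dependent, two-block factor.
   Context: Carries: put $r_1=t_1$, and for $1\le i\le k-1$ let $r_{i+1}\in T$ and $f_i\in N$ be the unique elements with $r_i t_{i+1}=r_{i+1}f_i$ (the $r_i$ are the successive remainders). A process $(B_i)_{1\le i\le k-1}$ is stationary if the joint law of $(B_j)_{j\in J}$ equals that of $(B_{j+m})_{j\in J}$ whenever $J,J+m\subseteq\{1,\dots,k-1\}$; one-dependent if $(B_j)_{j<i}$ and $(B_j)_{j>i}$ are independent for every $i$; a two-block factor if it has the form $B_i=h(Y_i,Y_{i+1})$ for a fixed function $h$ and independent identically distributed $Y_1,\dots,Y_k$. *)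

(* Defs.v *)
From HB Require Import structures.
From mathcomp Require Import all_boot all_order all_algebra all_fingroup all_solvable finmap.
From mathcomp Require Import all_classical all_reals all_analysis.

Set Implicit Arguments.
Unset Strict Implicit.
Unset Printing Implicit Defensive.

Import GRing.Theory Num.Theory.

Local Open Scope classical_set_scope.
Local Open Scope ereal_scope.

(* A finite group with its discrete sigma-algebra, so that group-valued random
   variables are random variables in the sense of the library. *)
Definition discrete_group (gT : finGroupType) : Type := gT.

HB.instance Definition _ (gT : finGroupType) :=
  Choice.copy (discrete_group gT) gT.
HB.instance Definition _ (gT : finGroupType) :=
  isPointed.Build (discrete_group gT) (1%g : gT).
HB.instance Definition _ (gT : finGroupType) :=
  @isMeasurable.Build default_measure_display (discrete_group gT)
    discrete_measurable discrete_measurable0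
    discrete_measurableC discrete_measurableU.

(* Sequences x_1, ..., x_n are functions on nat of which only the values at
   1 <= i <= n are ever constrained or used. *)
Definition indices (n : nat) : set nat := [set i | (1 <= i <= n)%N].

(* r i is the i-th successive remainder and f i the i-th carry produced when
   multiplying t 1, ..., t k. *)
Definition carries (gT : finGroupType) (N T : {set gT}) (k : nat)
    (t r f : nat -> gT) : Prop :=
  r 1%N = t 1%N /\
  forall i, indices k.-1 i ->
    [/\ r i.+1 \in T, f i \in N & (r i * t i.+1 = r i.+1 * f i)%g].

Section processes.
Context d (Omega : measurableType d) (R : realType) (P : probability Omega R).

Definition mutually_independent d' (S : measurableType d') (n : nat)
    (X : nat -> {RV P >-> S}) : Prop :=
  forall (J : {fset nat}) (A : nat -> set S),
    [set` J] `<=` indices n -> (forall i, measurable (A i)) ->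
    P (\bigcap_(i in [set` J]) (X i @^-1` A i)) =
      \prod_(i <- J) P (X i @^-1` A i).

Definition identically_distributed d' (S : measurableType d') (n : nat)
    (X : nat -> {RV P >-> S}) : Prop :=
  forall i j, indices n i -> indices n j ->
  forall A : set S, measurable A ->
    distribution P (X i) A = distribution P (X j) A.

(* Since T need not be a subgroup, this is uniformity on a finite subset; the
   values are required to lie in T everywhere, not just almost surely. *)
Definition uniform_on (gT : finGroupType) (T : {set gT})
    (X : {RV P >-> discrete_group gT}) : Prop :=
  (forall w, (X w : gT) \in T) /\
  (forall x : gT, x \in T ->
    distribution P X [set x] = ((#|T|%:R : R)^-1)%:E).

(* Law of a finite family of {0,1}-valued variables: {0,1}^I is finite, so that
   every E is an event as soon as the variables are measurable. *)
Definition joint_law (I : Type) (B : I -> Omega -> bool)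
    (E : set (I -> bool)) : \bar R :=
  P [set w | E (fun i => B i w)].

(* Shifts by m < 0 are obtained by exchanging J and J + m. *)
Definition stationary (n : nat) (B : nat -> Omega -> bool) : Prop :=
  forall (J : set nat) (m : nat),
    J `<=` indices n -> [set (j + m)%N | j in J] `<=` indices n ->
    joint_law (fun j : J => B (val j)) =
    joint_law (fun j : J => B (val j + m)%N).

Definition independent_families (I J : Type)
    (B : I -> Omega -> bool) (C : J -> Omega -> bool) : Prop :=
  forall (E : set (I -> bool)) (F : set (J -> bool)),
    P [set w | E (fun i => B i w) /\ F (fun j => C j w)] =
      joint_law B E * joint_law C F.

Definition one_dependent (n : nat) (B : nat -> Omega -> bool) : Prop :=
  forall i, indices n i ->
    independent_families
      (fun j : [set j | indices n j /\ (j < i)%N] => B (val j))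
      (fun j : [set j | indices n j /\ (i < j)%N] => B (val j)).

(* The state space S of the Y_i is arbitrary. In particular, each B i with
   1 <= i <= n is measurable. *)
Definition two_block_factor (n : nat) (B : nat -> Omega -> bool) : Prop :=
  exists (d' : measure_display) (S : measurableType d')
         (Y : nat -> {RV P >-> S}) (h : S * S -> bool),
    [/\ mutually_independent n.+1 Y,
        identically_distributed n.+1 Y,
        measurable_fun [set: S * S] h
      & forall i, indices n i -> forall w, B i w = h (Y i w, Y i.+1 w)].

End processes.

(* Main.v *)
(* Write [x] for the representative in T of the coset of x, so that
   r_{i+1} = [r_i t_{i+1}] and conversely t_{i+1} = [r_i^-1 r_{i+1}].  The map
   (t_1, ..., t_k) |-> (r_1, ..., r_k) is thus a bijection of T^k, and the
   remainders r_i are again independent and uniform on T.  Moreover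
   f_i = r_{i+1}^-1 r_i [r_i^-1 r_{i+1}] depends only on (r_i, r_{i+1}), so that
   the carries are a two-block factor of the r_i; a two-block factor of i.i.d.
   variables is stationary and one-dependent. *)
Require Import Defs.
From HB Require Import structures.
From mathcomp Require Import all_boot all_order all_algebra all_fingroup all_solvable finmap.
From mathcomp Require Import all_classical all_reals all_analysis.
From mathcomp Require Import zify.

Set Implicit Arguments.
Unset Strict Implicit.
Unset Printing Implicit Defensive.

Import GRing.Theory Num.Theory.

Local Open Scope classical_set_scope.
Local Open Scope ereal_scope.

(** * Independent variables with finitely many values *)

Section law.
Context d (Omega : measurableType d) (R : realType) (P : probability Omega R).

Lemma probability_finite_sum (Z : finType) (X : Omega -> Z) (D : set Z) :
  (forall z, measurable (X @^-1` [set z])) ->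
  P (X @^-1` D) = \sum_(z | z \in D) P (X @^-1` [set z]).
Proof.
move=> mX.
rewrite [X @^-1` D](_ : _ = \bigcup_(z in D) (X @^-1` [set z])); last first.
  by apply/seteqP; split=> [w Dw|w [z Dz Xw]];
    [exists (X w)|rewrite /preimage /= Xw].
rewrite measure_fin_bigcup //;
  [|exact: finite_finset|by move=> z z1 _ _ [w [/= <- <-]]].
rewrite (@bigfs _ _ _ _ (index_enum Z) (mem D)) ?index_enum_uniq //; last first.
  by move=> z _; rewrite mem_index_enum.
by rewrite set_mem_set.
Qed.

(** Moves independence from finite sets of naturals to families indexed by any finite type, through
    the finite set of values of [phi]. *)
Lemma independent_reindex d' (S : measurableType d') (n : nat)
  (X : nat -> {RV P >-> S}) (I : finType) (phi : I -> nat) (A : I -> set S) :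
  mutually_independent n X -> injective phi -> (forall i, indices n (phi i)) ->
  (forall i, measurable (A i)) ->
  P [set w | forall i, A i (X (phi i) w)] = \prod_i P (X (phi i) @^-1` A i).
Proof.
move=> indX phiI phin mA.
(* Pulls [A] back along [phi]. Off the image [setT] is used, because independence asks for a
   measurable set at every index. *)
pose A' m := if [pick i | phi i == m] is Some i then A i else setT.
have A'E i : A' (phi i) = A i.
  rewrite /A'; case: pickP => [j /eqP/phiI -> //|/(_ i)].
  by rewrite eqxx.
pose J := [fset phi i | i in I]%fset.
have := indX J A'.
rewrite big_imfset /=; last by move=> i j _ _; exact: phiI.
have -> : \bigcap_(i in [set` J]) (X i @^-1` A' i) =
    [set w | forall i, A i (X (phi i) w)].
  apply/seteqP; split=> w /=.
    move=> + i; move/(_ (phi i)); rewrite /= A'E; apply.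
    by apply/imfsetP; exists i.
  by move=> Aw j /imfsetP[i _ ->]; rewrite /= A'E.
move=> ->.
- rewrite big_enum /=; by apply: eq_bigr => i _; rewrite A'E.
- by move=> j /imfsetP[i _ ->].
- by move=> m; rewrite /A'; case: pickP.
Qed.

Section discrete.
Variable gT : finGroupType.

Lemma finite_tuple_measurable (I : finType)
  (X : I -> {RV P >-> discrete_group gT}) (D : set {ffun I -> gT}) :
  measurable [set w | D [ffun i => X i w : gT]].
Proof.
rewrite [X in measurable X](_ : _ = \bigcup_(y in D)
    \bigcap_(i in [set: I]) (X i @^-1` [set y i])); last first.
  apply/seteqP; split=> [w Dw|w [y Dy yw]] /=.
    by exists [ffun i => X i w : gT] => // i _ /=; rewrite ffunE.
  suff -> : [ffun i => X i w : gT] = y by [].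
  by apply/ffunP => i; rewrite ffunE; exact: (yw i).
apply: fin_bigcup_measurable; first exact: finite_finset.
move=> y _; apply: fin_bigcap_measurable; first exact: finite_finset.
by move=> i _; exact: measurable_funPTI.
Qed.

Lemma tuple_preimage1 (I : finType) (X : I -> Omega -> gT) (y : {ffun I -> gT}) :
  (fun w => [ffun i => X i w]) @^-1` [set y] = [set w | forall i, X i w = y i].
Proof.
apply/seteqP; split=> w /=.
  by move=> <- i; rewrite ffunE.
by move=> Xy; apply/ffunP => i; rewrite ffunE.
Qed.

(** Single pairs are measurable rectangles, so every set of pairs is a finite union of rectangles
    and lies in the product sigma-algebra. *)
Lemma discrete_pair_measurable d' (S : measurableType d')
  (h : discrete_group gT * discrete_group gT -> S) : measurable_fun setT h.
Proof.
move=> _ A _; rewrite setTI.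
rewrite [X in measurable X](_ : _ = \bigcup_(p in [set p : gT * gT | A (h p)])
    ([set p.1 : discrete_group gT] `*` [set p.2 : discrete_group gT])).
  apply: fin_bigcup_measurable; first exact: finite_finset.
  by move=> p _; exact: measurableX.
apply/seteqP; split=> [[a b] Ap|[a b] [[a' b'] Ap [/= -> ->]]] //.
by exists (a, b).
Qed.

(** * Independence from joint point masses of product form *)

Section point_masses.
Variables (n : nat) (Y : nat -> {RV P >-> discrete_group gT}) (mu : gT -> R).
Hypothesis mu1 : (\sum_x mu x = 1)%R.
Hypothesis pointY : forall y : {ffun 'I_n -> gT},
  P [set w | forall i : 'I_n, Y i.+1 w = y i] = (\prod_i mu (y i))%:E.

(** Expanding the product of sums gives one term for each tuple in the rectangle, namely its point
    mass. Since [mu] has total mass 1, taking [setT] at some positions then yields marginals and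
    independence. *)
Lemma point_masses_rectangle (A : nat -> set gT) :
  P [set w | forall i, (1 <= i <= n)%N -> A i (Y i w)] =
  (\prod_(1 <= i < n.+1) \sum_(x | x \in A i) mu x)%:E.
Proof.
rewrite big_add1 /= big_mkord bigA_distr_big_dep.
have -> : [set w | forall i, (1 <= i <= n)%N -> A i (Y i w)] =
    (fun w => [ffun i : 'I_n => Y i.+1 w : gT]) @^-1`
      [set y | forall i : 'I_n, A i.+1 (y i)].
  apply/seteqP; split=> w /= Aw.
    by move=> i; rewrite ffunE; apply: Aw; rewrite /= ltn_ord.
  case=> // i /= lt_in; have := Aw (Ordinal lt_in).
  by rewrite ffunE.
rewrite probability_finite_sum; last first.
  move=> y.
  exact: (@finite_tuple_measurable _ (fun i : 'I_n => Y i.+1) [set y]).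
rewrite -sumEFin; apply: eq_big => [y|y _].
  apply/idP/familyP => [|Ay].
    by rewrite inE /= => Ay i; apply/mem_set/Ay.
  by rewrite inE /= => i; apply/set_mem/Ay.
by rewrite tuple_preimage1 pointY.
Qed.

Lemma point_masses_marginal i (A : set gT) : indices n i ->
  P (Y i @^-1` A) = (\sum_(x | x \in A) mu x)%:E.
Proof.
move=> ni.
have := point_masses_rectangle (fun j => if j == i then A else setT).
rewrite (bigD1_seq i) ?iota_uniq ?mem_index_iota //= eqxx.
rewrite [X in (_ * X)%R]big1 ?mulr1 => [<-|j /negPf ->].
  congr (P _); apply/seteqP; split=> w /=.
    by move=> Aw j _; case: eqP => [->|].
  by move=> /(_ _ ni); rewrite eqxx.
by rewrite -mu1; apply: eq_bigl => x; rewrite in_setT.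
Qed.

Lemma point_masses_independent : mutually_independent n Y.
Proof.
move=> J A Jn mA.
have := point_masses_rectangle (fun j => if j \in J then A j else setT).
rewrite [X in P X](_ : _ = \bigcap_(i in [set` J]) (Y i @^-1` A i)); last first.
  apply/seteqP; split=> w /= Aw i.
    by move=> /= iJ; have := Aw i (Jn _ iJ); rewrite iJ.
  by case: ifPn => // iJ _; exact: Aw.
move=> ->; rewrite (bigID (mem J)) /= [X in (_ * X)%R]big1 ?mulr1; last first.
  move=> i /negPf ->; rewrite -mu1.
  by apply: eq_bigl => x; rewrite in_setT.
(* As [J] lies in 1..n, filtering this range by [J] lists exactly the elements of [J]. *)
rewrite -prodEFin -[LHS]big_filter (perm_big J); last first.
  apply: uniq_perm; rewrite ?filter_uniq ?iota_uniq ?fset_uniq // => i.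
  rewrite mem_filter mem_index_iota /= ltnS andb_idr //.
  exact: Jn.
rewrite !big_seq; apply: eq_bigr => i iJ.
rewrite iJ point_masses_marginal //; exact: Jn.
Qed.

End point_masses.

(** * Two-block factors of i.i.d. variables *)

Section iid.
Variables (n : nat) (Y : nat -> {RV P >-> discrete_group gT}) (mu : gT -> R).
Hypothesis indY : mutually_independent n Y.
Hypothesis lawY : forall i x, indices n i -> P (Y i @^-1` [set x]) = (mu x)%:E.

Lemma iid_point_mass (I : finType) (phi : I -> nat) (y : {ffun I -> gT}) :
  injective phi -> (forall i, indices n (phi i)) ->
  P [set w | forall i, Y (phi i) w = y i] = (\prod_i mu (y i))%:E.
Proof.
move=> phiI phin.
rewrite (@independent_reindex _ _ n Y I phi (fun i => [set y i])) //.
rewrite -prodEFin; apply: eq_bigr => i _; exact: lawY.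
Qed.

(** The right side does not involve [phi]: the law of a sample is the same whichever distinct
    positions are read. Stationarity rests on this. *)
Lemma iid_law (I : finType) (phi : I -> nat) (D : set {ffun I -> gT}) :
  injective phi -> (forall i, indices n (phi i)) ->
  P [set w | D [ffun i => Y (phi i) w : gT]] =
  (\sum_(y | y \in D) \prod_i mu (y i))%:E.
Proof.
move=> phiI phin.
rewrite (@probability_finite_sum _ (fun w => [ffun i => Y (phi i) w : gT]) D).
  rewrite -sumEFin; apply: eq_bigr => y _.
  by rewrite tuple_preimage1 iid_point_mass.
by move=> y; exact: (@finite_tuple_measurable I (fun i => Y (phi i)) [set y]).
Qed.

(** Two disjoint samples form one sample indexed by [I + J], whose point masses split into one
    factor for each. *)
Lemma iid_independent (I J : finType) (phi : I -> nat) (psi : J -> nat)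
  (D : set {ffun I -> gT}) (F : set {ffun J -> gT}) :
  injective phi -> injective psi -> (forall i j, phi i <> psi j) ->
  (forall i, indices n (phi i)) -> (forall j, indices n (psi j)) ->
  P [set w | D [ffun i => Y (phi i) w : gT] /\ F [ffun j => Y (psi j) w : gT]] =
  P [set w | D [ffun i => Y (phi i) w : gT]] *
  P [set w | F [ffun j => Y (psi j) w : gT]].
Proof.
move=> phiI psiI phipsi phin psin.
rewrite !iid_law // -EFinM big_distrlr /=.
rewrite (@probability_finite_sum _
  (fun w => ([ffun i => Y (phi i) w : gT], [ffun j => Y (psi j) w : gT]))
  (D `*` F)); last first.
  move=> [y z].
  rewrite [X in measurable X](_ : _ =
    [set w | [set y] [ffun i => Y (phi i) w : gT]] `&`
    [set w | [set z] [ffun j => Y (psi j) w : gT]]); last first.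
    by apply/seteqP; split=> w /= [-> ->].
  apply: measurableI; exact: finite_tuple_measurable.
rewrite pair_big /= -sumEFin; apply: eq_big => [[y z]|[y z] _] /=.
  by rewrite in_setX.
have := @iid_point_mass (I + J)%type
  (fun u => match u with inl i => phi i | inr j => psi j end)
  [ffun u => match u with inl i => y i | inr j => z j end].
rewrite big_sumType /=; under eq_bigr do rewrite ffunE.
under [X in (_ * X)%R]eq_bigr do rewrite ffunE.
move=> <-.
- congr (P _); apply/seteqP; split=> w /=.
  + by move=> [<- <-] [i|j]; rewrite !ffunE.
  + move=> yz; congr pair; apply/ffunP => i; rewrite ffunE.
      by have := yz (inl i); rewrite ffunE.
    by have := yz (inr i); rewrite ffunE.
- move=> [i|i] [j|j] //; first by move/phiI ->.
  + by move/phipsi.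
  + by move/esym/phipsi.
  + by move/psiI ->.
- by case.
Qed.

Lemma iid_stationary (h : gT * gT -> bool) :
  stationary P n.-1 (fun i w => h (Y i w, Y i.+1 w)).
Proof.
move=> J m Jn Jmn; apply/funext => E; rewrite /joint_law.
(* The window consists of the first [n - m] variables, so that its shift by [m] stays within 1..n.
   Positions are read from 1, hence [i.-1]; the default [1%g] is never met by a block with index in
   [J]. *)
pose ext (y : {ffun 'I_(n - m) -> gT}) (i : nat) : gT :=
  if insub i.-1 is Some j then y j else 1%g.
pose D : set {ffun 'I_(n - m) -> gT} :=
  [set y | E (fun j : J => h (ext y (val j), ext y (val j).+1))].
(* Both sides of stationarity are instances, with [s] the identity and the shift by [m]. Commuting
   with the successor makes [s] send blocks to blocks. *)
suff law_shift s : (forall i, s i.+1 = (s i).+1) -> injective s ->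
    (forall i, (0 < i <= n - m)%N -> indices n (s i)) ->
    P [set w | E (fun j : J => h (Y (s (val j)) w, Y (s (val j)).+1 w))] =
    (\sum_(y | y \in D) \prod_i mu (y i))%:E.
  rewrite (law_shift id) // ?(law_shift (addn^~ m)) //.
  - exact: addIn.
  - by move=> i; rewrite /indices /=; lia.
  - by move=> i; rewrite /indices /=; lia.
move=> sS sI sn.
rewrite -(@iid_law _ (fun i : 'I_(n - m) => s i.+1)); last 2 first.
- by move=> i j /sI[/val_inj].
- by move=> i; apply: sn; have := ltn_ord i; lia.
congr (P _); apply/funext => w /=; congr (E _); apply/funext => j.
have jJ : J (sval j) := set_valP j.
have /andP[j0 _] : (1 <= sval j <= n.-1)%N := Jn _ jJ.
have /andP[_ jm] : (1 <= sval j + m <= n.-1)%N.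
  by apply: Jmn; exists (sval j).
have extE i : (0 < i <= (sval j).+1)%N ->
    ext [ffun i : 'I_(n - m) => Y (s i.+1) w : gT] i = Y (s i) w.
  move=> /andP[i0 ij]; rewrite /ext insubT.
    by lia.
  by move=> ?; rewrite ffunE /= prednK.
by rewrite !extE ?sS //=; lia.
Qed.

(** Blocks before [i] read only the variables 1..i and blocks after [i] only the variables i+1..n;
    block [i] alone straddles the cut. *)
Lemma iid_one_dependent (h : gT * gT -> bool) :
  one_dependent P n.-1 (fun i w => h (Y i w, Y i.+1 w)).
Proof.
move=> i /andP[i0 ik] E F.
pose ext l (y : {ffun 'I_l -> gT}) (i : nat) : gT :=
  if insub i is Some j then y j else 1%g.
have extE l s w j : (j < l)%N ->
    ext l [ffun a : 'I_l => Y (s (val a)) w : gT] j = Y (s j) w.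
  move=> jl; rewrite /ext insubT ffunE //.
(* Tuples are numbered from 0 here: variable [j] sits at [j.-1] in the first group and at [j - i.+1]
   in the second. *)
pose D : set {ffun 'I_i -> gT} := [set y |
  E (fun j => h (ext _ y (val j).-1, ext _ y (val j)))].
pose D' : set {ffun 'I_(n - i) -> gT} := [set y |
  F (fun j => h (ext _ y (val j - i.+1)%N, ext _ y (val j - i)%N))].
have ED w : E (fun j => h (Y (val j) w, Y (val j).+1 w)) =
    D [ffun a : 'I_i => Y (a.+1) w : gT].
  congr (E _); apply/funext => j.
  have [/andP[j0 jn] ji] : (1 <= val j <= n.-1)%N /\ (val j < i)%N :=
    set_valP j.
  by rewrite !extE ?prednK //; lia.
have FD w : F (fun j => h (Y (val j) w, Y (val j).+1 w)) =
    D' [ffun a : 'I_(n - i) => Y (i.+1 + a)%N w : gT].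
  congr (F _); apply/funext => j.
  have [/andP[j0 jn] ji] : (1 <= val j <= n.-1)%N /\ (i < val j)%N :=
    set_valP j.
  rewrite !(extE _ (addn i.+1)); [|lia|lia].
  by rewrite subnKC // addSn subnKC // ltnW.
rewrite /joint_law.
under eq_fun do rewrite ED FD.
under [in RHS]eq_fun do rewrite ED.
under [X in _ * P X]eq_fun do rewrite FD.
apply: (@iid_independent _ _ (fun a : 'I_i => a.+1)
  (fun a : 'I_(n - i) => i.+1 + a)%N).
- by move=> a b [/val_inj].
- by move=> a b /addnI/val_inj.
- by move=> a b; have := ltn_ord a; lia.
- by move=> a; have := ltn_ord a; rewrite /indices /=; lia.
- by move=> a; have := ltn_ord a; rewrite /indices /=; lia.
Qed.
End iid.
End discrete.

Lemma eq_stationary (n : nat) (B C : nat -> Omega -> bool) :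
  (forall i, indices n i -> B i = C i) -> stationary P n B -> stationary P n C.
Proof.
move=> BC statB J m Jn Jmn; have := statB J m Jn Jmn.
have -> : (fun j : J => B (val j)) = (fun j : J => C (val j)).
  by apply/funext => j; apply: BC; apply: Jn; exact: set_valP.
have -> // : (fun j : J => B (val j + m)%N) = (fun j : J => C (val j + m)%N).
apply/funext => j; apply: BC; apply: Jmn.
by exists (val j) => //; exact: set_valP.
Qed.

Lemma eq_one_dependent (n : nat) (B C : nat -> Omega -> bool) :
  (forall i, indices n i -> B i = C i) ->
  one_dependent P n B -> one_dependent P n C.
Proof.
move=> BC depB i ni; have := depB i ni.
have BCE (Q : nat -> Prop) :
    (fun j : [set j | indices n j /\ Q j] => B (val j)) =
    (fun j : [set j | indices n j /\ Q j] => C (val j)).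
  by apply/funext => j; apply: BC; have [] := set_valP j.
by rewrite (BCE (fun j => (j < i)%N)) (BCE (fun j => (i < j)%N)).
Qed.

End law.

(** * Transversals of a normal subgroup *)

Section transversal.
Variables (gT : finGroupType) (G N : {group gT}) (tau : coset_of N -> gT).
Hypothesis nNG : normal N G.
Hypothesis tau_rep :
  forall s : coset_of N, s \in (G / N)%g -> tau s \in (s : {set gT}).
Let T := (tau @: (G / N)%g)%SET.
Let rep x := tau (coset N x).

Lemma transversal_norm x : x \in G -> x \in 'N(N)%g.
Proof. exact: fintype.subsetP (normal_norm nNG) x. Qed.

Lemma cosetM x y : x \in G -> y \in G ->
  coset N (x * y)%g = (coset N x * coset N y)%g.
Proof.
by move=> xG yG; exact: morphM (transversal_norm xG) (transversal_norm yG).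
Qed.

Lemma coset_transversal s : s \in (G / N)%g -> coset N (tau s) = s.
Proof. by move=> /tau_rep/coset_mem. Qed.

Lemma rep_transversal x : x \in G -> rep x \in T.
Proof. by move=> xG; apply: imset_f; exact: mem_quotient. Qed.

Lemma transversal_sub x : x \in T -> x \in G.
Proof.
move=> /imsetP[s sGN ->]; have := tau_rep sGN.
case/morphimP: sGN => y yN yG -> ; rewrite val_coset //.
move=> /rcosetP[z zN ->]; rewrite groupM //.
exact: fintype.subsetP (normal_sub nNG) z zN.
Qed.

Lemma rep_id x : x \in T -> rep x = x.
Proof. by move=> /imsetP[s sGN ->]; rewrite /rep coset_transversal. Qed.

Lemma coset_rep x : x \in G -> coset N (rep x) = coset N x.
Proof. by move=> xG; rewrite coset_transversal ?mem_quotient. Qed.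

(** Left multiplication by [a] permutes the cosets of [N], and [T] meets each coset in [G / N] once,
    so [rep (a * x)] permutes [T], with inverse given by [a^-1]. *)
Lemma rep_mul_eq a b x : a \in G -> b \in T -> x \in T ->
  rep (a * x)%g = b <-> x = rep (a^-1 * b)%g.
Proof.
move=> aG bT xT; have [bG xG] := (transversal_sub bT, transversal_sub xT).
split=> [<-|->].
  have repG : rep (a * x)%g \in G.
    by rewrite transversal_sub ?rep_transversal ?groupM.
  rewrite -[LHS]rep_id //; congr tau.
  rewrite cosetM ?groupV // coset_rep ?groupM //.
  by rewrite -cosetM ?groupM ?groupV // mulKg.
have repG : rep (a^-1 * b)%g \in G.
  by rewrite transversal_sub ?rep_transversal ?groupM ?groupV.
rewrite -[RHS]rep_id //; congr tau.
rewrite cosetM // coset_rep ?groupM ?groupV //.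
by rewrite -cosetM ?groupM ?groupV // mulKVg.
Qed.

(** This is the bijection between factors and remainders: prescribing all remainders amounts to
    prescribing all factors. Both sequences start at 1 in position 0, so the first step is no
    exception. *)
Lemma remainder_path (k : nat) (t r y : nat -> gT) :
  y 0%N = 1%g -> r 0%N = 1%g ->
  (forall i, (i < k)%N -> y i.+1 \in T) ->
  (forall i, (i < k)%N -> t i.+1 \in T) ->
  (forall i, (i < k)%N -> r i.+1 = rep (r i * t i.+1)%g) ->
  (forall i, (i < k)%N -> r i.+1 = y i.+1) <->
  (forall i, (i < k)%N -> t i.+1 = rep ((y i)^-1 * y i.+1)%g).
Proof.
move=> y0 r0 yT tT rE.
have yG i : (i < k)%N -> y i \in G.
  by case: i => [|i ik]; rewrite ?y0 ?group1 // transversal_sub // yT // ltnW.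
split=> ry i ik.
  apply/rep_mul_eq; rewrite ?yG ?yT ?tT // -ry // rE //.
  by case: i ik => [|i] ik; rewrite ?r0 ?y0 // ry // ltnW.
(* Induction is needed here: the value of the next factor is expressed through [y i], so [r i] must
   already be identified with [y i]. *)
elim: i ik => [|i IHi] ik; rewrite rE //; apply/rep_mul_eq; rewrite ?yT ?tT //.
- by rewrite r0 group1.
- by rewrite ry // r0 y0.
- by rewrite IHi ?yG // ltnW.
- by rewrite IHi ?ry // ltnW.
Qed.

End transversal.

(** * The remainders as random variables, and the carries as their blocks *)

Lemma discrete_pair_rv d (Omega : measurableType d) (R : realType)
  (P : probability Omega R) (gT : finGroupType) (g : gT -> gT -> gT)
  (X Y : {RV P >-> discrete_group gT}) :
  exists Z : {RV P >-> discrete_group gT}, forall w, Z w = g (X w) (Y w).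
Proof.
have mZ : measurable_fun setT (fun w => g (X w) (Y w) : discrete_group gT).
  have mg := discrete_pair_measurable
    (fun p : discrete_group gT * discrete_group gT =>
       g p.1 p.2 : discrete_group gT).
  have mXY : measurable_fun setT (fun w => (X w, Y w)).
    by apply: measurable_fun_pair; exact: measurable_funPT.
  exact: measurableT_comp mg mXY.
pose mZ_mixin := isMeasurableFun.Build _ _ _ _ _ mZ.
pose Z : {mfun Omega >-> discrete_group gT} :=
  HB.pack (fun w => g (X w) (Y w)) mZ_mixin.
by exists Z.
Qed.

Theorem corollary6p2
  (gT : finGroupType) (G N : {group gT})
  (nNG : normal N G) (sNZ : N \subset 'Z(G)%g)
  (tau : coset_of N -> gT)
  (tau_rep : forall s : coset_of N, s \in (G / N)%g -> tau s \in (s : {set gT}))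
  (tau1 : tau 1%g = 1%g)
  (k : nat) (k_ge2 : (2 <= k)%N)
  (R : realType) (d : measure_display) (Omega : measurableType d)
  (P : probability Omega R)
  (t : nat -> {RV P >-> discrete_group gT})
  (t_unif : forall i, indices k i -> uniform_on (tau @: (G / N)%g) (t i))
  (t_indep : mutually_independent k t)
  (r f : nat -> Omega -> gT)
  (rf_carries : forall w : Omega,
    carries N (tau @: (G / N)%g) k (fun i => t i w)
      (fun i => r i w) (fun i => f i w)) :
  let B : nat -> Omega -> bool := fun i w => f i w != 1%g in
  [/\ stationary P k.-1 B, one_dependent P k.-1 B & two_block_factor P k.-1 B].
Proof.
move=> B.
have k_gt0 : (0 < k)%N by exact: ltnW.
set T := (tau @: (G / N)%g)%SET in t_unif rf_carries.
pose rep x := tau (coset N x).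
(* Setting r_0 = 1 makes r_{i+1} = rep (r_i t_{i+1}) hold from i = 0 on. *)
pose rr i w := if i is 0%N then 1%g else r i w.
have tT i w : (i < k)%N -> t i.+1 w \in T.
  by move=> ik; exact: (t_unif i.+1 ik).1.
have rT i w : (i < k)%N -> rr i.+1 w \in T.
  have [r1 rf] := rf_carries w.
  case: i => [|i] ik /=; first by rewrite r1 tT.
  by have [] := rf i.+1; rewrite // /indices /=; lia.
have rrG i w : (i <= k)%N -> rr i w \in G.
  case: i => [|i] ik; first exact: group1.
  exact: (transversal_sub nNG tau_rep (rT _ _ ik)).
have rS i w : (i < k)%N -> rr i.+1 w = rep (rr i w * t i.+1 w)%g.
  have [r1 rf] := rf_carries w.
  move=> ik; case: i ik (rT _ w ik) (rrG i w (ltnW ik)) => [|i] ik rSiT rG.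
    by rewrite /= r1 mul1g /rep (rep_id tau_rep) // tT.
  have ki : indices k.-1 i.+1 by rewrite /indices /=; lia.
  (* The carry lies in [N], so the product and the new remainder share a coset; the remainder, being
     in [T], is its representative. *)
  have [_ fN rtE] := rf _ ki.
  rewrite /rep rtE -[LHS](rep_id tau_rep) //; congr tau.
  by rewrite coset_kerr.
(* No measurability of [r] is assumed: the recursion builds random variables from the factors, and
   they agree with the remainders up to index [k]. *)
have [Y YE] : exists Y : nat -> {RV P >-> discrete_group gT},
    forall i, (i <= k)%N -> forall w, Y i w = rr i w.
  suff : forall i, exists Z : {RV P >-> discrete_group gT},
      (i <= k)%N -> forall w, Z w = rr i w by move=> /choice[Y YE]; exists Y.
  elim=> [|i [Z ZE]].
    by exists (cst (1%g : discrete_group gT)).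
  have [Z' Z'E] := discrete_pair_rv (fun a x => rep (a * x)%g) Z (t i.+1).
  by exists Z' => ik w; rewrite Z'E ZE ?rS // ltnW.
(* The uniform law on [T], extended by zero to the whole group. *)
pose mu x : R := if x \in T then (#|T|%:R)^-1%R else 0%R.
have T_neq0 : (#|T|%:R != 0 :> R)%R.
  by rewrite pnatr_eq0 -lt0n (cardD1 (tau 1%g)) imset_f ?group1.
have mu1 : (\sum_x mu x = 1)%R.
  by rewrite -big_mkcond /= sumr_const -[LHS]mulr_natr mulVf.
have pointY (y : {ffun 'I_k -> gT}) :
    P [set w | forall i : 'I_k, Y i.+1 w = y i] = (\prod_i mu (y i))%:E.
  (* If some entry of [y] is outside [T], both sides vanish, because remainders always lie in
     [T]. *)
  have [yT|/existsP[i yiT]] := boolP [forall i, y i \in T]; last first.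
    rewrite (bigD1 i) //= {1}/mu (negPf yiT) mul0r.
    rewrite [X in P X](_ : _ = set0) ?measure0 //.
    apply/seteqP; split=> w //= /(_ i) Yi; move: yiT.
    by rewrite -Yi YE // rT.
  (* Renumbers [y] from 1, with the initial remainder 1 in position 0; the default beyond [k] is
     never read. *)
  pose z i := if i is j.+1 then oapp y 1%g (insub j) else 1%g.
  have zE (i : 'I_k) : z i.+1 = y i by rewrite /z valK.
  have zT i : (i < k)%N -> z i.+1 \in T.
    by move=> ik; rewrite (zE (Ordinal ik)); exact: forallP yT _.
  have zG i : (i <= k)%N -> z i \in G.
    case: i => [|i] ik; first exact: group1.
    exact: (transversal_sub nNG tau_rep (zT _ ik)).
  (* The event on the remainders becomes one fixing each factor at a value in [T]; independence and
     uniformity of the factors then give the product of the masses 1/|T|. *)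
  rewrite [X in P X](_ : _ = [set w | forall i : 'I_k,
      [set rep ((z i)^-1 * z i.+1)%g] (t i.+1 w)]); last first.
    apply/funext => w /=; apply/propext.
    have path_iff := @remainder_path _ _ _ _ nNG tau_rep k (fun i => t i w)
      (rr^~ w) z erefl erefl zT (fun i => @tT i w) (fun i => @rS i w).
    split=> [Yy i|tz i].
      apply: path_iff.1 => // j jk; rewrite -YE //.
      by rewrite (Yy (Ordinal jk)) -zE.
    rewrite YE // -zE; apply: path_iff.2 => // j jk.
    exact: (tz (Ordinal jk)).
  rewrite (@independent_reindex _ _ _ _ _ _ k t _ (fun i : 'I_k => i.+1)
    (fun i : 'I_k => [set rep ((z i)^-1 * z i.+1)%g])) //; last 2 first.
  - by move=> i j [/val_inj].
  - by move=> i; rewrite /indices /= ltn_ord.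
  rewrite -prodEFin; apply: eq_bigr => i _.
  rewrite /mu (forallP yT i).
  apply: (t_unif i.+1 _).2; first by rewrite /indices /= ltn_ord.
  apply: (rep_transversal tau).
  by rewrite groupM ?groupV ?zG // ltnW.
have indY := point_masses_independent mu1 pointY.
have lawY i A := @point_masses_marginal _ _ _ _ _ _ _ _ mu1 pointY i A.
pose h (p : discrete_group gT * discrete_group gT) : bool :=
  (p.2^-1 * (p.1 * rep (p.1^-1 * p.2)))%g != 1%g.
have BE i w : indices k.-1 i -> B i w = h (Y i w, Y i.+1 w).
  move=> ki; have /andP[i0 ik] := ki.
  have ltik : (i < k)%N by lia.
  have [_ rf] := rf_carries w.
  have [_ _ rtE] := rf _ ki.
  rewrite /B /h /= !YE ?(ltnW ltik) //.
  (* Two consecutive remainders determine the factor between them. With it restored, the argument of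
     the test in [h] is [r_{i+1}^-1 * (r_i * t_{i+1})], which is the carry. *)
  have <- : t i.+1 w = rep ((rr i w)^-1 * rr i.+1 w)%g.
    apply/(rep_mul_eq nNG tau_rep); rewrite ?rrG ?(ltnW ltik) ?rT ?tT //.
    by rewrite rS.
  by case: i i0 {ki ik ltik} rtE => // i _ /= ->; rewrite mulKg.
have BYE i : indices k.-1 i -> (fun w => h (Y i w, Y i.+1 w)) = B i.
  by move=> ki; apply/funext => w; rewrite BE.
have lawY1 i x : indices k i -> P (Y i @^-1` [set x]) = (mu x)%:E.
  move=> ki; rewrite lawY // (big_pred1 x) // => y.
  by apply/idP/eqP; rewrite inE.
split.
- exact: (eq_stationary BYE (iid_stationary indY lawY1 h)).
- exact: (eq_one_dependent BYE (iid_one_dependent indY lawY1 h)).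
- exists default_measure_display, (discrete_group gT), Y, h; rewrite prednK //.
  split=> //.
  + by move=> i j ki kj A _; rewrite /distribution /= /pushforward !lawY.
  + exact: discrete_pair_measurable.
  + by move=> i ki w; exact: BE.
Qed.
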